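(* Let $C$ be a multi-rotationally symmetric planar convex body, with maximal degree $k_C$ and minimal degree $\chi_C\geq 3$, and let $R$ be the circumradius of $C$. Let $\{k_1=\chi_C,\ldots,k_n=k_C\}$ be the set of divisors of $k_C$ greater than $1$, with $k_1<\ldots<k_n$, and denote by $P_{k_i}$ the standard $k_i$-partition of $C$, $i=1,\ldots,n$. Then the minimal value in $$\{d_M(P_{k_1}),\ldots,d_M(P_{k_n})\}$$ is uniquely attained by $d_M(P_{k_n})$ (that is, attained for the index $n$ and for no other index) if and only if $d_M(P_{k_{n-1}})\neq R$.
   Context: A planar convex body is a compact convex subset of $\mathbb{R}^2$ with non-empty interior. Its circumradius is the radius of the smallest disk containing it. For $k\in\mathbb{N}$, $k\geq 2$, a planar convex body $C$ is $k$-rotationally symmetric if there is a point $p\in C$ (the center of symmetry of $C$) such that $C$ is invariant under the rotation of angle $2\pi/k$ about $p$. $C$ is multi-rotationally symmetric if it is $k$-rotationally symmetric for more than one value of $k$. The minimal degree $\chi_C$ is the smallest $k\geq 2$ for which $C$ is $k$-rotationally symmetric; if $C$ is not a circle (i.e. a disk), the maximal degree $k_C$ is the largest such $k$. (A circle has minimal degree $2$.) $C$ is $k$-rotationally symmetric exactly when $k$ is a divisor of $k_C$ greater than $1$; in particular $n\geq 2$ for a multi-rotationally symmetric $C$. Standard $k$-partition: let $C$ be $k$-rotationally symmetric with center of symmetry $p$. Let $x_1,\ldots,x_k$ be points of $\partial C$ at minimal distance to $p$, symmetrically placed along $\partial C$ (they are the images of one such point under the rotations about $p$ of angles that are multiples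 of $2\pi/k$). The line segments $\overline{p\,x_i}$ divide $C$ into $k$ connected congruent (closed) subsets $C_1,\ldots,C_k$; this decomposition is the standard $k$-partition $P_k$ associated to $C$. The maximum relative diameter of a decomposition $P$ of $C$ into subsets $C_1,\ldots,C_k$ is $d_M(P)=\max\{D(C_i): i=1,\ldots,k\}$, where $D(C_i)=\max\{d(x,y):x,y\in C_i\}$ is the Euclidean diameter. *)

(* Defs.v *)
From mathcomp Require Import all_boot all_order all_algebra.
From mathcomp Require Import all_classical all_reals all_analysis.

Set Implicit Arguments.
Unset Strict Implicit.
Unset Printing Implicit Defensive.

Import Order.TTheory GRing.Theory Num.Theory numFieldNormedType.Exports.

Local Open Scope classical_set_scope.
Local Open Scope ring_scope.

Section PlanarGeometry.
Context {R : realType}.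

Local Notation plane := 'rV[R]_2.

(* The library norm on 'rV[R]_2 is the sup norm: it is only used for the
   (usual) topology, all distances are measured with [eucl_dist]. *)
Definition eucl_dist (x y : plane) : R :=
  Num.sqrt (\sum_(i < 2) (x ord0 i - y ord0 i) ^+ 2).

Definition closed_disk (c : plane) (r : R) : set plane :=
  [set x | eucl_dist c x <= r].

Definition diameter (A : set plane) : R :=
  sup [set eucl_dist z.1 z.2 | z in A `*` A].

Definition circumradius (C : set plane) : R :=
  inf [set r | exists c, C `<=` closed_disk c r].

Definition convex_body (C : set plane) : Prop :=
  [/\ compact C, convex_set (C : set (convex_lmodType plane)) &
      interior C !=set0].

Definition boundary (C : set plane) : set plane := closure C `\` interior C.

Definition segment (x y : plane) : set plane :=
  [set x + t *: (y - x) | t in `[0, 1]].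

Definition rotation (p : plane) (theta : R) (x : plane) : plane :=
  let v := x - p in
  p + \row_(j < 2)
        if j == ord0 then cos theta * v ord0 ord0 - sin theta * v ord0 ord_max
        else sin theta * v ord0 ord0 + cos theta * v ord0 ord_max.

Definition symmetry_center (C : set plane) (k : nat) (p : plane) : Prop :=
  C p /\ rotation p (2 * pi / k%:R) @` C = C.

Definition rot_symmetric (C : set plane) (k : nat) : Prop :=
  (2 <= k)%N /\ exists p, symmetry_center C k p.

Definition multi_rot_symmetric (C : set plane) : Prop :=
  exists j k, [/\ j <> k, rot_symmetric C j & rot_symmetric C k].

Definition minimal_degree (C : set plane) (chi : nat) : Prop :=
  rot_symmetric C chi /\ forall k, rot_symmetric C k -> (chi <= k)%N.

(* No number is a maximal degree of a disk. *)
Definition maximal_degree (C : set plane) (m : nat) : Prop :=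
  rot_symmetric C m /\ forall k, rot_symmetric C k -> (k <= m)%N.

Definition nearest_boundary_point (C : set plane) (p x : plane) : Prop :=
  boundary C x /\ forall y, boundary C y -> eucl_dist p x <= eucl_dist p y.

(* The union of the segments joining p to the k images of x under the
   rotations about p of angles multiple of 2 pi / k. *)
Definition spokes (k : nat) (p x : plane) : set plane :=
  \bigcup_(i < k) segment p (rotation p (i%:R * (2 * pi / k%:R)) x).

(* The closed pieces into which the spokes divide C. *)
Definition pieces (C : set plane) (k : nat) (p x : plane) : set (set plane) :=
  let D := C `\` spokes k p x in
  [set closure (connected_component D y) | y in D].

(* The nearest boundary point x is not unique, and may be any of them. *)
Definition standard_partition (C : set plane) (k : nat) (P : set (set plane)) :
    Prop :=
  exists p x, [/\ symmetry_center C k p, nearest_boundary_point C p x &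
                  P = pieces C k p x].

(* A standard partition has finitely many pieces, so that this [sup] is a
   maximum. *)
Definition max_rel_diameter (P : set (set plane)) : R :=
  sup [set diameter A | A in P].

(* Among d 1, ..., d n, the minimal value is d j. *)
Definition minimum_at (n : nat) (d : nat -> R) (j : nat) : Prop :=
  (1 <= j <= n)%N /\ forall i, (1 <= i <= n)%N -> d j <= d i.

Definition minimum_only_at (n : nat) (d : nat -> R) (j : nat) : Prop :=
  forall i, minimum_at n d i <-> i = j.

End PlanarGeometry.

(* Main.v *)
Require Import Defs.
From mathcomp Require Import all_boot all_order all_algebra.
From mathcomp Require Import all_classical all_reals all_analysis.
From mathcomp Require Import ring lra.

Set Implicit Arguments.
Unset Strict Implicit.
Unset Printing Implicit Defensive.

Import Order.TTheory GRing.Theory Num.Theory numFieldNormedType.Exports.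

Local Open Scope classical_set_scope.
Local Open Scope ring_scope.

(** The proof rests on the formula
   [d_M(P_k) = max (R, l_k)] with [l_k = 2 r sin (pi / k)], valid for every
   order [k >= 3] of a rotational symmetry of [C]. Here [r] is the distance from the
   center [p] to the boundary, and [l_k], called [chord] below, is the distance
   between the ends of two consecutive spokes. Since [l_k] decreases strictly
   with [k], the sequence [d_M(P_{k_i})] decreases strictly as long as it
   exceeds [R] and equals [R] from there on; so its last term is the only
   minimum exactly when the last but one still exceeds [R]
   ([minimum_only_at_last]).

   For the formula, [R] is the largest distance from [p] to a point of [C]: the
   points of an orbit average to [p], so a disk that contains [C] can be moved
   to the center [p] without enlarging it ([recenter_disk]). The same
   computation shows that all rotational symmetries of [C] have the same
   center, hence that [r] does not depend on [k].

   The lower bound holds because the piece between two consecutive spokes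
   contains [p], the two ends of the spokes and, after a rotation, a point of
   [C] farthest from [p] ([sector_sub_piece]). For the upper bound, the open
   disk of center [p] and radius [r] lies in [C], so at the end of each spoke
   the perpendicular to the spoke is a support line of [C] ([support_line]).
   Every piece therefore lies in the kite bounded by two consecutive spokes and
   the perpendiculars at their ends, and also in the disk of radius [R]; two
   points of such a region are at distance at most [max (R, l_k)] when the
   angle between the spokes is at most 120 degrees ([kite_bound]). This is
   where the minimal degree enters: it excludes [k = 2].

   The last but one divisor exists because symmetries of orders [j] and [k]
   about the same center compose to one of order [lcm j k]
   ([symmetry_center_lcm]): every order divides [kC], and there are two. *)

(** * Vectors of the plane *)

Section Vectors.
Context {R : realType}.
Local Notation plane := 'rV[R]_2.
Implicit Types (u v w a b p x y z : plane) (s t c r theta : R).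

Definition dot u v : R :=
  u ord0 ord0 * v ord0 ord0 + u ord0 ord_max * v ord0 ord_max.

Definition cross u v : R :=
  u ord0 ord0 * v ord0 ord_max - u ord0 ord_max * v ord0 ord0.

Definition rotv theta v : plane :=
  \row_(j < 2) if j == ord0
    then cos theta * v ord0 ord0 - sin theta * v ord0 ord_max
    else sin theta * v ord0 ord0 + cos theta * v ord0 ord_max.

Lemma planeP u v :
  u ord0 ord0 = v ord0 ord0 -> u ord0 ord_max = v ord0 ord_max -> u = v.
Proof.
move=> e0 e1; apply/rowP => j.
have [->//|->//] : j = ord0 \/ j = ord_max.
by case: j => [[|[|//]]] ij; [left|right]; apply/val_inj.
Qed.

Lemma rotv0 theta v :
  rotv theta v ord0 ord0 = cos theta * v ord0 ord0 - sin theta * v ord0 ord_max.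
Proof. by rewrite mxE. Qed.

Lemma rotv1 theta v : rotv theta v ord0 ord_max
  = sin theta * v ord0 ord0 + cos theta * v ord0 ord_max.
Proof. by rewrite mxE. Qed.

Definition coordE := (rotv0, rotv1, mxE).

Lemma rotationE p theta x : rotation p theta x = p + rotv theta (x - p).
Proof. by []. Qed.

Lemma eucl_distE x y : eucl_dist x y = Num.sqrt (dot (x - y) (x - y)).
Proof.
rewrite /eucl_dist /dot big_ord_recr big_ord1 /= !mxE !expr2.
by have -> : widen_ord (leqnSn 1) ord0 = ord0 :> 'I_2 by apply/val_inj.
Qed.

Lemma dot_ge0 v : 0 <= dot v v.
Proof. by rewrite /dot -!expr2 addr_ge0 ?sqr_ge0. Qed.

Lemma dot_eq0 v : dot v v = 0 -> v = 0.
Proof.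
rewrite /dot -!expr2 => /eqP; rewrite paddr_eq0 ?sqr_ge0 // !sqrf_eq0.
by move=> /andP[/eqP e0 /eqP e1]; apply: planeP; rewrite ?e0 ?e1 mxE.
Qed.

Lemma rotvD theta eta v : rotv (theta + eta) v = rotv theta (rotv eta v).
Proof. by apply: planeP; rewrite !coordE sinD cosD /=; ring. Qed.

Lemma rotv_id v : rotv 0 v = v.
Proof. by apply: planeP; rewrite !coordE cos0 sin0 /=; ring. Qed.

Lemma rotvK theta v : rotv (- theta) (rotv theta v) = v.
Proof. by rewrite -rotvD addNr rotv_id. Qed.

Lemma rotvKn theta v : rotv theta (rotv (- theta) v) = v.
Proof. by rewrite -rotvD subrr rotv_id. Qed.

Lemma dot_rotv theta u v : dot (rotv theta u) (rotv theta v) = dot u v.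
Proof.
by rewrite -[RHS]mul1r -(cos2Dsin2 theta) /dot !coordE /=; ring.
Qed.

Lemma dot_rotvD theta eta v :
  dot (rotv theta v) (rotv eta v) = cos (eta - theta) * dot v v.
Proof. by rewrite /dot !coordE cosB /=; ring. Qed.

Lemma cross_rotvD theta eta v :
  cross (rotv theta v) (rotv eta v) = sin (eta - theta) * dot v v.
Proof. by rewrite /cross /dot !coordE sinB /=; ring. Qed.


Lemma cross_decomp a b v : cross a b != 0 ->
  v = (cross v b / cross a b) *: a + (cross a v / cross a b) *: b.
Proof.
rewrite /cross => ab0; apply: planeP; rewrite !mxE;
  move: (a _ _) (a _ _) (b _ _) (b _ _) (v _ _) (v _ _) ab0;
  by move=> a0 a1 b0 b1 v0 v1 ab0; field.
Qed.

Lemma dotC u v : dot u v = dot v u.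
Proof. by rewrite /dot; ring. Qed.

Lemma dot_combl a b w s t :
  dot (s *: a + t *: b) w = s * dot a w + t * dot b w.
Proof. by rewrite /dot !mxE; ring. Qed.

Lemma dot_subC u v : dot (u - v) (u - v) = dot (v - u) (v - u).
Proof. by rewrite /dot !mxE; ring. Qed.

Lemma dot_comb a b s t :
  dot (s *: a + t *: b) (s *: a + t *: b)
  = s ^+ 2 * dot a a + 2 * s * t * dot a b + t ^+ 2 * dot b b.
Proof. by rewrite /dot !mxE; ring. Qed.

Lemma dot_cross_sqr a b :
  dot a b ^+ 2 + cross a b ^+ 2 = dot a a * dot b b.
Proof. by rewrite /dot /cross; ring. Qed.

Lemma cross_rotv theta u v : cross (rotv theta u) (rotv theta v) = cross u v.
Proof. by rewrite -[RHS]mul1r -(cos2Dsin2 theta) /cross !coordE /=; ring. Qed.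

Lemma crossC u v : cross u v = - cross v u.
Proof. by rewrite /cross; ring. Qed.

Lemma crossZr u v t : cross u (t *: v) = t * cross u v.
Proof. by rewrite /cross !mxE; ring. Qed.

Lemma crossDr u v w : cross u (v + w) = cross u v + cross u w.
Proof. by rewrite /cross !mxE; ring. Qed.

Lemma crossDl u v w : cross (v + w) u = cross v u + cross w u.
Proof. by rewrite /cross !mxE; ring. Qed.

Lemma crossZl u v t : cross (t *: u) v = t * cross u v.
Proof. by rewrite /cross !mxE; ring. Qed.

Lemma cross_self u : cross u u = 0.
Proof. by rewrite /cross; ring. Qed.

Lemma rotvDr theta u v : rotv theta (u + v) = rotv theta u + rotv theta v.
Proof. by apply: planeP; rewrite !coordE /=; ring. Qed.

Lemma rotv_zero theta : rotv theta (0 : plane) = 0.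
Proof. by apply: planeP; rewrite !coordE /=; ring. Qed.

Lemma addrKl p u : p + u - p = u.
Proof. by rewrite addrAC subrr add0r. Qed.

Lemma eucl_dist_le p z r :
  eucl_dist p z <= r <-> 0 <= r /\ dot (z - p) (z - p) <= r ^+ 2.
Proof.
rewrite eucl_distE dot_subC; split=> [h|[r0 h]].
  have r0 : 0 <= r by apply: le_trans h; rewrite sqrtr_ge0.
  split=> //; rewrite -(sqr_sqrtr (dot_ge0 (z - p))).
  by rewrite lerXn2r // nnegrE // sqrtr_ge0.
by rewrite -(ger0_norm r0) -sqrtr_sqr ler_sqrt ?sqr_ge0.
Qed.

End Vectors.

(** * Two points of a kite *)

Section Kite.
Context {R : realType}.
Local Notation plane := 'rV[R]_2.
Implicit Types (u v w a b p x y z : plane) (s t c r theta : R).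

(** Let [a], [b] be unit vectors whose angle has cosine [c]. The points
   [s a + t b] considered here fill the triangle between the chord [ab] and the
   tangents to the unit circle at [a] and [b]; its longest side is [ab] as long
   as the angle is at most 120 degrees, and [2 (1 - c)] is the square of that
   side. With [S = s + t] and [D = s - t] the triangle is given by [1 <= S] and
   [|D| (1 - c) <= 2 - S (1 + c)], and the squared length of [s a + t b] is
   [((1 + c) S^2 + (1 - c) D^2) / 2]. *)
Lemma cap_bound c s t s' t' : - (1 / 2) <= c -> c < 1 ->
  1 <= s + t -> s + c * t <= 1 -> c * s + t <= 1 ->
  1 <= s' + t' -> s' + c * t' <= 1 -> c * s' + t' <= 1 ->
  (s - s') ^+ 2 + 2 * c * ((s - s') * (t - t')) + (t - t') ^+ 2 <= 2 * (1 - c).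
Proof.
move=> c1 c2 h1 h2 h3 h1' h2' h3'.
(* The triangle becomes [0 <= A] and [e |D| <= e - A]; for [A] and [B] between
   [0] and [e] the inequality [key] amounts to
   [A (e - A) + B (e - B) + A B >= 0]. *)
pose A := (s + t - 1) * (1 + c); pose B := (s' + t' - 1) * (1 + c).
pose e := 1 - c.
have e0 : 0 < e by rewrite /e; lra.
have A0 : 0 <= A by rewrite /A; apply: mulr_ge0; lra.
have B0 : 0 <= B by rewrite /B; apply: mulr_ge0; lra.
have Ae : A <= e by rewrite /A /e; nra.
have Be : B <= e by rewrite /B /e; nra.
pose d := e * ((s - s') - (t - t')).
have d1 : d <= 2 * e - (A + B) by rewrite /d /A /B /e; lra.
have d2 : - (2 * e - (A + B)) <= d by rewrite /d /A /B /e; lra.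
have dd : d ^+ 2 <= (2 * e - (A + B)) ^+ 2.
  rewrite -subr_ge0 subr_sqr mulr_ge0 //; lra.
have AB : (A - B) ^+ 2 * e <= 3 * (1 + c) * (A - B) ^+ 2.
  by rewrite mulrC ler_wpM2r ?sqr_ge0 // /e; lra.
have key : 3 * (A - B) ^+ 2 + (2 * e - (A + B)) ^+ 2 <= 4 * e ^+ 2.
  by nra.
have id : 2 * e * (1 + c) *
    ((s - s') ^+ 2 + 2 * c * ((s - s') * (t - t')) + (t - t') ^+ 2) =
  (A - B) ^+ 2 * e + d ^+ 2 * (1 + c).
  by rewrite /A /B /d /e; ring.
have pos : 0 < 2 * e * (1 + c) by rewrite !mulr_gt0 //; lra.
rewrite -(ler_pM2l pos) id.
have : d ^+ 2 * (1 + c) <= (2 * e - (A + B)) ^+ 2 * (1 + c).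
  by rewrite ler_wpM2r //; lra.
have : (3 * (A - B) ^+ 2 + (2 * e - (A + B)) ^+ 2) * (1 + c) <= 4 * e ^+ 2 * (1 + c).
  by rewrite ler_wpM2r //; lra.
rewrite -/e; lra.
Qed.

(** By convexity the distance to [w] is largest at a vertex of the triangle
   [0, a, b]: the weighted mean of the squared distances to the vertices exceeds
   it by their variance. *)
Lemma dist_triangle a b w s t T : 0 <= s -> 0 <= t -> s + t <= 1 ->
  dot w w <= T -> dot (a - w) (a - w) <= T -> dot (b - w) (b - w) <= T ->
  dot (s *: a + t *: b - w) (s *: a + t *: b - w) <= T.
Proof.
move=> s0 t0 st h0 ha hb.
have -> : dot (s *: a + t *: b - w) (s *: a + t *: b - w) =
    s * dot (a - w) (a - w) + t * dot (b - w) (b - w) + (1 - s - t) * dot w w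
    - (s * t * dot (a - b) (a - b) + s * (1 - s - t) * dot a a
       + t * (1 - s - t) * dot b b).
  by rewrite /dot !mxE; ring.
have u0 : 0 <= 1 - s - t by lra.
have V : 0 <= s * t * dot (a - b) (a - b) + s * (1 - s - t) * dot a a
    + t * (1 - s - t) * dot b b.
  by rewrite !addr_ge0 // mulr_ge0 ?dot_ge0 // mulr_ge0.
have := ler_wpM2l s0 ha; have := ler_wpM2l t0 hb; have := ler_wpM2l u0 h0.
lra.
Qed.

(** The points [z] and [w] lie in the kite bounded by the vectors [a], [b] and
   the perpendiculars at their ends, and in a disk about [0]. The chord [ab]
   cuts the kite into two triangles. On the triangle [0, a, b] convexity moves
   a point to a vertex: to [0], where the disk gives the bound, or to [a] or
   [b], which belong also to the other triangle; there [cap_bound] applies. *)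
Lemma kite_bound a b z w T :
  dot a a = dot b b -> 0 < cross a b -> - dot a a <= 2 * dot a b ->
  dot a a <= T -> dot (a - b) (a - b) <= T ->
  0 <= cross a z -> 0 <= cross z b ->
  dot a z <= dot a a -> dot b z <= dot a a -> dot z z <= T ->
  0 <= cross a w -> 0 <= cross w b ->
  dot a w <= dot a a -> dot b w <= dot a a -> dot w w <= T ->
  dot (z - w) (z - w) <= T.
Proof.
move=> eab cab ang aT abT az zb daz dbz zT aw wb daw dbw wT.
set r2 := dot a a in eab ang aT daz dbz daw dbw *.
have r0 : 0 < r2.
  rewrite lt_neqAle dot_ge0 andbT eq_sym; apply/eqP => r20.
  have := dot_cross_sqr a b; rewrite -/r2 r20 mul0r => /eqP.
  by rewrite paddr_eq0 ?sqr_ge0 // !sqrf_eq0 (gt_eqF cab) andbF.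
pose c := dot a b / r2.
have cE : dot a b = r2 * c by rewrite /c mulrC divfK ?gt_eqF.
have c1 : - (1 / 2) <= c.
  by rewrite -(ler_pM2l r0) -cE; lra.
have c2 : c < 1.
  rewrite -(ltr_pM2l r0) -cE mulr1 ltNge; apply/negP => h.
  have := dot_cross_sqr a b; rewrite -/r2 -eab => e.
  have : r2 * r2 <= dot a b ^+ 2 by rewrite expr2 ler_pM // ltW.
  by have := exprn_gt0 2 cab; lra.
have abE : dot (a - b) (a - b) = r2 * (2 * (1 - c)).
  by rewrite -[a]scale1r -scaleN1r dot_comb -eab -/r2 cE; ring.
have ba : dot b a = r2 * c by rewrite dotC.
have decomp v : 0 <= cross a v -> 0 <= cross v b ->
    dot a v <= r2 -> dot b v <= r2 ->
    exists s t, [/\ v = s *: a + t *: b, 0 <= s, 0 <= t,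
      s + c * t <= 1 & c * s + t <= 1].
  move=> h1 h2 h3 h4; exists (cross v b / cross a b), (cross a v / cross a b).
  have e := cross_decomp v (lt0r_neq0 cab).
  split=> //; rewrite ?divr_ge0 ?(ltW cab) //.
    rewrite -(ler_pM2l r0) mulr1 -[X in _ <= X]/r2; apply: le_trans h3.
    by rewrite [X in _ <= dot _ X]e dotC dot_combl -/r2 ba; lra.
  rewrite -(ler_pM2l r0) mulr1; apply: le_trans h4.
  by rewrite [X in _ <= dot _ X]e dotC dot_combl -eab cE; lra.
(* Both points beyond the chord. *)
have far s t s' t' : 1 <= s + t -> s + c * t <= 1 -> c * s + t <= 1 ->
    1 <= s' + t' -> s' + c * t' <= 1 -> c * s' + t' <= 1 ->
    dot (s *: a + t *: b - (s' *: a + t' *: b))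
        (s *: a + t *: b - (s' *: a + t' *: b)) <= T.
  move=> *; apply: le_trans abT; rewrite abE.
  have -> : s *: a + t *: b - (s' *: a + t' *: b) =
      (s - s') *: a + (t - t') *: b by apply: planeP; rewrite !mxE; ring.
  rewrite dot_comb -eab -/r2 cE.
  rewrite [leLHS](_ : _ = r2 * ((s - s') ^+ 2 + 2 * c * ((s - s') * (t - t'))
    + (t - t') ^+ 2)); last by ring.
  by rewrite ler_pM2l //; apply: cap_bound.
have vertex v : 0 <= cross a v -> 0 <= cross v b ->
    dot a v <= r2 -> dot b v <= r2 ->
    dot (a - v) (a - v) <= T /\ dot (b - v) (b - v) <= T.
  move=> h1 h2 h3 h4; have [s [t [-> s0 t0 st1 st2]]] := decomp v h1 h2 h3 h4.
  have [st|/ltW st] := leP 1 (s + t).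
    split.
      have -> : a - (s *: a + t *: b) = 1 *: a + 0 *: b - (s *: a + t *: b).
        by rewrite scale1r scale0r addr0.
      by apply: far => //; lra.
    have -> : b - (s *: a + t *: b) = 0 *: a + 1 *: b - (s *: a + t *: b).
      by rewrite scale1r scale0r add0r.
    by apply: far => //; lra.
  rewrite ![dot (_ - (_ + _)) _]dot_subC.
  have v0 : dot (0 : plane) 0 = 0 by rewrite /dot !mxE; ring.
  have T0 : 0 <= T by apply: le_trans aT; exact: ltW.
  split; apply: dist_triangle => //; rewrite ?subrr ?v0 // -?eab //.
  by rewrite dot_subC.
have [aw' bw'] := vertex w aw wb daw dbw.
have [s [t [zE s0 t0 st1 st2]]] := decomp z az zb daz dbz.
have [st|/ltW st] := leP (s + t) 1; first by rewrite zE; apply: dist_triangle.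
have [az' bz'] := vertex z az zb daz dbz.
have [s' [t' [wE s0' t0' st1' st2']]] := decomp w aw wb daw dbw.
have [st'|/ltW st'] := leP (s' + t') 1.
  by rewrite dot_subC wE; apply: dist_triangle.
by rewrite zE wE; apply: far.
Qed.

End Kite.

(** * Rotational symmetries and the circumradius *)

Section Symmetry.
Context {R : realType}.
Local Notation plane := 'rV[R]_2.
Implicit Types (C : set plane) (u v w a b p x y z : plane) (s t c r theta : R).
Implicit Types (i j k m : nat).

Definition turn k : R := 2 * pi / k%:R.

Lemma turn_mul k : (0 < k)%N -> k%:R * turn k = pi *+ 2.
Proof.
move=> k0; rewrite /turn mulrC divfK ?pnatr_eq0 -?lt0n //.
by rewrite mulrC mulr_natr.
Qed.

Lemma turn_gt0 k : (0 < k)%N -> 0 < turn k.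
Proof. by move=> k0; rewrite /turn !mulr_gt0 ?pi_gt0 ?invr_gt0 ?ltr0n. Qed.

Lemma turn_le_pi k : (2 <= k)%N -> turn k <= pi.
Proof.
move=> k2; rewrite /turn ler_pdivrMr ?ltr0n ?(leq_trans _ k2) //.
by rewrite mulrC ler_wpM2l ?pi_ge0 // ler_nat.
Qed.

Lemma turn_lt j k : (0 < j)%N -> (j < k)%N -> turn k < turn j.
Proof.
move=> j0 jk; have k0 := leq_ltn_trans (leq0n j) jk.
rewrite /turn ltr_pM2l ?mulr_gt0 ?pi_gt0 //.
by rewrite ltf_pV2 ?posrE ?ltr0n // ltr_nat.
Qed.

Lemma cos_turn_lt1 k : (2 <= k)%N -> cos (turn k) < 1.
Proof.
move=> k2; have k0 : (0 < k)%N by exact: leq_trans k2.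
rewrite -(@cos0 R) ltr_cos ?turn_gt0 // in_itv /= ?lexx ?pi_ge0 //.
by rewrite ltW ?turn_gt0 // turn_le_pi.
Qed.

Lemma rotv_periodic v : rotv (pi *+ 2) v = v.
Proof. by apply: planeP; rewrite !coordE cos2pi sin2pi /=; ring. Qed.

Lemma rotv_fixed theta v : cos theta < 1 -> rotv theta v = v -> v = 0.
Proof.
move=> c1 e; apply: dot_eq0.
have := dot_rotvD 0 theta v; rewrite rotv_id e subr0 => h.
have : (1 - cos theta) * dot v v = 0 by rewrite mulrBl mul1r -h subrr.
by move/eqP; rewrite mulf_eq0 gt_eqF ?subr_gt0 //= => /eqP.
Qed.

(** The sum of an orbit is fixed by a nontrivial rotation. *)
Lemma sum_orbit k v : (2 <= k)%N ->
  \sum_(i < k) rotv (i%:R * turn k) v = 0.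
Proof.
move=> k2; have k0 : (0 < k)%N by exact: leq_trans k2.
apply: (rotv_fixed (cos_turn_lt1 k2)).
rewrite (big_morph _ (rotvDr (turn k)) (rotv_zero (turn k))).
have e i : rotv (turn k) (rotv (i%:R * turn k) v) = rotv (i.+1%:R * turn k) v.
  by rewrite -rotvD -[in RHS]add1n natrD mulrDl mul1r.
under eq_bigr do rewrite e.
case: k k2 k0 e => // k _ k0 _.
rewrite big_ord_recr big_ord_recl /= turn_mul // rotv_periodic mul0r rotv_id.
by rewrite addrC.
Qed.

Lemma sum_dist_orbit k u v : (2 <= k)%N ->
  \sum_(i < k) dot (rotv (i%:R * turn k) v - u) (rotv (i%:R * turn k) v - u)
  = k%:R * (dot v v + dot u u).
Proof.
move=> k2.
have e a : dot (a - u) (a - u) = dot a a + dot u u - 2 * dot a u.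
  by rewrite /dot !mxE; ring.
under eq_bigr do rewrite e dot_rotv.
have dotD a b : dot (a + b) u = dot a u + dot b u by rewrite /dot !mxE; ring.
have dot0 : dot 0 u = 0 by rewrite /dot !mxE; ring.
rewrite sumrB sumr_const card_ord -mulr_sumr.
rewrite -(big_morph (fun a => dot a u) dotD dot0) sum_orbit // dot0.
by rewrite mulr0 subr0 mulr_natl.
Qed.

(** Stated as an equivalence on position vectors relative to [p], so that the
   group laws of [theta] follow from those of [rotv] without images of sets. *)
Definition rot_invariant C p theta :=
  forall v, C (p + v) <-> C (p + rotv theta v).

Lemma rot_invariantD C p theta eta :
  rot_invariant C p theta -> rot_invariant C p eta -> rot_invariant C p (theta + eta).
Proof. by move=> h1 h2 v; rewrite rotvD -h1 -h2. Qed.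

Lemma rot_invariantN C p theta : rot_invariant C p theta -> rot_invariant C p (- theta).
Proof. by move=> h v; rewrite [X in _ <-> X]h rotvKn. Qed.

Lemma rot_invariantM C p theta i :
  rot_invariant C p theta -> rot_invariant C p (i%:R * theta).
Proof.
move=> h; elim: i => [|i ih]; first by move=> v; rewrite mul0r rotv_id.
by rewrite -addn1 natrD mulrDl mul1r; exact: rot_invariantD.
Qed.

Lemma symmetry_centerP C k p :
  symmetry_center C k p <-> C p /\ rot_invariant C p (turn k).
Proof.
rewrite /symmetry_center -/(turn k); split=> [[Cp h]|[Cp h]]; split=> //.
  have h1 v : C (p + v) -> C (p + rotv (turn k) v).
    move=> Cv; rewrite -h; exists (p + v) => //.
    by rewrite rotationE addrAC subrr add0r.
  move=> v; split; first exact: h1.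
  rewrite -{1}h => -[z Cz]; rewrite rotationE => /addrI e.
  by rewrite -(rotvK (turn k) v) -e rotvK addrC subrK.
apply/seteqP; split=> [_ [z Cz <-]|z Cz].
  by rewrite rotationE -h addrC subrK.
exists (p + rotv (- turn k) (z - p)).
  by rewrite h rotvKn addrC subrK.
by rewrite rotationE addrAC subrr add0r rotvKn addrC subrK.
Qed.

(** The disk about [p + u] of squared radius [r] contains the orbit of [p + v].
   Since the orbit averages to [p], the mean squared distance of its points to
   [p + u] is [dot v v + dot u u]. *)
Lemma recenter_disk C k p u v r : (2 <= k)%N -> rot_invariant C p (turn k) ->
  (forall w, C (p + w) -> dot (w - u) (w - u) <= r) ->
  C (p + v) -> dot v v + dot u u <= r.
Proof.
move=> k2 inv h Cv; have k0 : 0 < k%:R :> R by rewrite ltr0n (leq_trans _ k2).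
rewrite -(ler_pM2l k0) -sum_dist_orbit // -[k in leRHS](card_ord k).
rewrite mulr_natl -sumr_const; apply: ler_sum => i _; apply: h.
by have /(_ v) [+ _] := rot_invariantM i inv; apply.
Qed.

Lemma circumradius_center C k p y :
  (2 <= k)%N -> symmetry_center C k p -> C y ->
  (forall z, C z -> dot (z - p) (z - p) <= dot (y - p) (y - p)) ->
  circumradius C = Num.sqrt (dot (y - p) (y - p)).
Proof.
move=> k2 /symmetry_centerP [_ inv] Cy far.
set r := Num.sqrt _.
set E : set R := [set s | exists q, C `<=` closed_disk q s].
have rE : E r.
  exists p => z Cz; apply/eucl_dist_le; split; first exact: sqrtr_ge0.
  by rewrite sqr_sqrtr ?dot_ge0 // far.
have lb : lbound E r.
  move=> s [q Cs]; have /eucl_dist_le[s0 _] := Cs _ Cy.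
  rewrite -(ger0_norm s0) -sqrtr_sqr; apply: ler_wsqrtr.
  apply: le_trans (_ : _ <= dot (y - p) (y - p) + dot (q - p) (q - p)) _.
    by rewrite lerDl dot_ge0.
  apply: (recenter_disk k2 inv); last by rewrite addrC subrK.
  by move=> w /Cs /eucl_dist_le[_]; rewrite opprB addrA [w + p]addrC.
apply/eqP; rewrite eq_le; apply/andP; split.
  by apply: ge_inf => //; exists r.
by apply: lb_le_inf => //; exists r.
Qed.

(** Recentering the least disk about [p] that contains [C] at [q], and the
   result at [p] again, gains the squared distance of [p] and [q]. *)
Lemma symmetry_center_unique C k m p q y :
  (2 <= k)%N -> (2 <= m)%N -> symmetry_center C k p -> symmetry_center C m q ->
  C y -> (forall z, C z -> dot (z - p) (z - p) <= dot (y - p) (y - p)) ->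
  p = q.
Proof.
move=> k2 m2 /symmetry_centerP [_ ip] /symmetry_centerP [_ iq] Cy far.
have farq z : C z -> dot (z - q) (z - q) <= dot (y - p) (y - p).
  move=> Cz; apply: le_trans (_ : _ <= dot (z - q) (z - q) + dot (p - q) (p - q)) _.
    by rewrite lerDl dot_ge0.
  apply: (recenter_disk m2 iq); last by rewrite addrC subrK.
  by move=> w /far; rewrite opprB addrA [w + q]addrC.
have h : dot (y - p) (y - p) + dot (q - p) (q - p) <= dot (y - p) (y - p).
  apply: (recenter_disk k2 ip); last by rewrite addrC subrK.
  by move=> w /farq; rewrite opprB addrA [w + p]addrC.
apply/esym/eqP; rewrite -subr_eq0; apply/eqP/dot_eq0/eqP.
by rewrite eq_le dot_ge0 andbT -(lerD2l (dot (y - p) (y - p))) addr0.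
Qed.

(** Bezout: [1 / lcm k m = gcd k m / (k m) = (i k - j m) / (k m)]. *)
Lemma turn_lcm k m : (0 < k)%N -> (0 < m)%N ->
  exists i j : nat, turn (lcmn k m) = i%:R * turn m - j%:R * turn k.
Proof.
move=> k0 m0; have [i j e _] := egcdnP m k0.
exists i, j; rewrite /turn.
have g0 : (gcdn k m)%:R != 0 :> R by rewrite pnatr_eq0 -lt0n gcdn_gt0 k0.
have -> : 2 * pi / (lcmn k m)%:R = 2 * pi * (gcdn k m)%:R / (k%:R * m%:R) :> R.
  by rewrite -natrM -muln_lcm_gcd natrM -mulf_div divff // mulr1.
have -> : (gcdn k m)%:R = i%:R * k%:R - j%:R * m%:R :> R.
  by rewrite -!natrM e natrD addrAC subrr add0r.
by field; rewrite !pnatr_eq0 -!lt0n k0 m0.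
Qed.

Lemma symmetry_center_lcm C k m p : (0 < k)%N -> (0 < m)%N ->
  symmetry_center C k p -> symmetry_center C m p ->
  symmetry_center C (lcmn k m) p.
Proof.
move=> k0 m0 /symmetry_centerP [Cp ik] /symmetry_centerP [_ im].
apply/symmetry_centerP; split=> //.
have [i [j ->]] := turn_lcm k0 m0.
by apply: rot_invariantD; [|apply: rot_invariantN]; apply: rot_invariantM.
Qed.

End Symmetry.

(** * Convex bodies, inscribed disks and support lines *)

Section Topology.
Context {R : realType}.
Local Notation plane := 'rV[R]_2.
Implicit Types (C : set plane) (u v w a b p x y z : plane) (s t c r theta : R).
Implicit Types (i k m : nat).

Lemma convex_comb C x y t : convex_set (C : set (convex_lmodType plane)) ->
  C x -> C y -> 0 <= t <= 1 -> C (t *: x + (1 - t) *: y).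
Proof.
move=> conv Cx Cy /andP[t0 t1].
have := conv x y (Itv01 t0 t1); rewrite !inE; exact.
Qed.

Lemma continuous_sub p : continuous (fun z : plane => z - p).
Proof. by move=> z; apply: continuousB; [exact: cvg_id|exact: cst_continuous]. Qed.

Lemma continuous_homothety p t : continuous (fun z : plane => t *: (z - p)).
Proof.
move=> z; apply: (@continuousZl_tmp _ _ _ (fun z : plane => z - p)).
exact: continuous_sub.
Qed.

Lemma continuous_subcoord p (j : 'I_2) :
  continuous (fun z : plane => (z - p) ord0 j).
Proof.
move=> z; apply: (@continuous_comp _ _ _ (fun z : plane => z - p)
  (fun z : plane => z ord0 j)).
  exact: continuous_sub.
exact: coord_continuous.
Qed.

Lemma continuous_dot p u : continuous (fun z : plane => dot u (z - p)).
Proof.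
pose f (j : 'I_2) (z : plane) : R^o := u ord0 j * (z - p) ord0 j.
have cf j : continuous (f j).
  move=> z; apply: (@continuousM _ _ (fun=> u ord0 j)).
    exact: cst_continuous.
  exact: continuous_subcoord.
by move=> z; apply: (@continuousD _ _ _ (f ord0) (f ord_max)); exact: cf.
Qed.

Lemma continuous_norm2 p : continuous (fun z : plane => dot (z - p) (z - p)).
Proof.
pose f (j : 'I_2) (z : plane) : R^o := (z - p) ord0 j * (z - p) ord0 j.
have cf j : continuous (f j).
  by move=> z; apply: (@continuousM _ _ (fun z : plane => (z - p) ord0 j)
    (fun z : plane => (z - p) ord0 j)); exact: continuous_subcoord.
by move=> z; apply: (@continuousD _ _ _ (f ord0) (f ord_max)); exact: cf.
Qed.

(** [cross u] is the scalar product with the vector [u] turned by a right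
   angle. *)
Lemma continuous_cross p u : continuous (fun z : plane => cross u (z - p)).
Proof.
have -> : (fun z : plane => cross u (z - p)) =
    (fun z : plane => dot (rotv (pi / 2) u) (z - p)).
  by apply/funext => z; rewrite /dot /cross !coordE cos_pihalf sin_pihalf; ring.
exact: continuous_dot.
Qed.

(** The homothety with center [w] and ratio [s] maps a neighborhood of [u]
   inside [C] to a neighborhood of [s *: u + (1 - s) *: w] inside [C]. *)
Lemma interior_conv C u w s : convex_set (C : set (convex_lmodType plane)) ->
  interior C u -> C w -> 0 < s <= 1 -> interior C (s *: u + (1 - s) *: w).
Proof.
move=> conv Cu Cw /andP[s0 s1]; have sn0 := lt0r_neq0 s0.
pose f z : plane := s^-1 *: (z - (1 - s) *: w).
have fu : f (s *: u + (1 - s) *: w) = u.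
  by rewrite /f addrK scalerA mulVf // scale1r.
have : nbhs (s *: u + (1 - s) *: w) (f @^-1` C).
  have cf := continuous_homothety (t := s^-1) (p := (1 - s) *: w)
    (x := s *: u + (1 - s) *: w).
  by apply: cf; rewrite -/(f _) fu.
apply: filterS => z /= Cf.
have -> : z = s *: f z + (1 - s) *: w.
  by rewrite /f scalerA mulfV // scale1r subrK.
by apply: convex_comb => //; rewrite s1 ltW.
Qed.

Lemma farthest_point C p : compact C -> C !=set0 ->
  exists2 y, C y & forall z, C z -> dot (z - p) (z - p) <= dot (y - p) (y - p).
Proof.
move=> cC C0.
have [|y yC h] := compact_EVT_max (f := fun z => dot (z - p) (z - p)) C0 cC.
  by apply: continuous_subspaceT; exact: continuous_norm2.
by exists y; [exact: set_mem|move=> z Cz; apply: h; exact: mem_set].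
Qed.

Lemma continuous_line x v : continuous (fun t : R => x + t *: v).
Proof.
move=> t; apply: (@continuousD _ _ _ (fun=> x) (fun t : R => t *: v)).
  exact: cst_continuous.
by apply: (@continuousZr_tmp _ _ _ (fun t : R => t)); exact: cvg_id.
Qed.

Lemma connected_segment x y : connected (segment x y).
Proof.
apply: (connected_continuous_connected (f := fun t : R => x + t *: (y - x))).
  exact: segment_connected.
by apply: continuous_subspaceT; exact: continuous_line.
Qed.

Lemma segmentE x y z : segment x y z <->
  exists2 t, 0 <= t <= 1 & z = (1 - t) *: x + t *: y.
Proof.
have e t : x + t *: (y - x) = (1 - t) *: x + t *: y.
  by apply: planeP; rewrite !mxE; ring.
split=> [[t] /=|[t t01 ->]].
  by rewrite in_itv /= => t01 <-; exists t; rewrite ?e.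
by exists t; rewrite //= in_itv.
Qed.

(** The center is the average of the orbit of the interior point [u]: it lies
   strictly between [u] and the average of the other points of the orbit, which
   belongs to [C]. *)
Lemma center_interior C k p u : convex_set (C : set (convex_lmodType plane)) ->
  (2 <= k)%N -> symmetry_center C k p -> interior C u -> interior C p.
Proof.
move=> conv k2 /symmetry_centerP [Cp inv] Cu.
have Cu' := interior_subset Cu.
pose o i := rotv (i%:R * turn k) (u - p).
have Co i : C (p + o i).
  by have /(_ (u - p)) [+ _] := rot_invariantM i inv; apply; rewrite addrC subrK.
have avg m : C (p + m.+1%:R^-1 *: \sum_(1 <= i < m.+2) o i).
  elim: m => [|m ih].
    by rewrite big_nat1 invr1 scale1r; exact: Co.
  have -> : p + m.+2%:R^-1 *: \sum_(1 <= i < m.+3) o i =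
      m.+2%:R^-1 *: (p + o m.+2) + (1 - m.+2%:R^-1) *:
        (p + m.+1%:R^-1 *: \sum_(1 <= i < m.+2) o i).
    rewrite big_nat_recr //=; move: (\sum_(_ <= _ < _) _) => S.
    have n0 : m.+1%:R != 0 :> R by rewrite pnatr_eq0.
    have n1 : m.+2%:R = m.+1%:R + 1 :> R by rewrite -addn1 natrD.
    have n2 : m.+1%:R + 1 != 0 :> R by rewrite -n1 pnatr_eq0.
    move: n0 n2; rewrite n1; move: (m.+1%:R) => r n0 n2.
    by apply: planeP; rewrite !mxE; field; rewrite n0 n2.
  apply: convex_comb => //; rewrite invr_ge0 ler0n /=.
  by rewrite invf_le1 ?ltr0n // ler1n.
case: k k2 inv @o Co avg => // -[//|m] _ inv o Co avg.
have n0 : m.+1%:R != 0 :> R by rewrite pnatr_eq0.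
have n1 : m.+2%:R = m.+1%:R + 1 :> R by rewrite -addn1 natrD.
have n2 : m.+1%:R + 1 != 0 :> R by rewrite -n1 pnatr_eq0.
have S0 : u - p + \sum_(1 <= i < m.+2) o i = 0.
  rewrite -[RHS](@sum_orbit _ m.+2 (u - p)) // -(big_mkord xpredT o).
  by rewrite big_nat_recl // big_add1 /= /o mul0r rotv_id.
have pE : p = m.+2%:R^-1 *: u + (1 - m.+2%:R^-1) *:
    (p + m.+1%:R^-1 *: \sum_(1 <= i < m.+2) o i).
  have -> : \sum_(1 <= i < m.+2) o i = p - u.
    by apply/eqP; rewrite -subr_eq0 opprB addrC S0.
  move: n0 n2; rewrite n1; move: (m.+1%:R) => r n0 n2.
  by apply: planeP; rewrite !mxE; field; rewrite n0 n2.
rewrite pE; apply: interior_conv => //.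
by rewrite invr_gt0 ltr0n /= invf_le1 ?ltr0n // ler1n.
Qed.

(** The open disk about [p] that reaches to the nearest boundary point lies in
   [C]: a segment from [p] to a point outside [C] meets the boundary, because
   segments are connected. *)
Lemma disk_sub C p x z : interior C p -> nearest_boundary_point C p x ->
  dot (z - p) (z - p) < dot (x - p) (x - p) -> C z.
Proof.
move=> Cp [_ near] zx.
have segz : segment p z z.
  by apply/segmentE; exists 1; rewrite ?lexx ?ler01 // subrr scale0r add0r scale1r.
have segp : segment p z p.
  by apply/segmentE; exists 0; rewrite ?lexx ?ler01 // subr0 scale0r addr0 scale1r.
have conn := @connected_segment p z.
have /(_ _ _ _) e := conn (segment p z `&` interior C).
suff : (segment p z `&` interior C) z by move=> [_ /interior_subset].
rewrite e //; first by exists p.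
  by exists (interior C) => //; exact: open_interior.
exists (closure C); first exact: closed_closure.
apply/seteqP; split=> w [segw Cw]; split=> //.
  by apply: subset_closure; exact: interior_subset.
apply: contrapT => nw; have /near : boundary C w by [].
case: segw => t; rewrite /= in_itv /= => /andP[t0 t1] wE.
have : dot (w - p) (w - p) <= dot (z - p) (z - p).
  rewrite -wE addrAC subrr add0r.
  have -> : dot (t *: (z - p)) (t *: (z - p)) = t ^+ 2 * dot (z - p) (z - p).
    by rewrite /dot !mxE; ring.
  by rewrite ler_piMl ?dot_ge0 // exprn_ile1.
rewrite !eucl_distE ![dot (p - _) _]dot_subC => h1.
rewrite ler_sqrt ?dot_ge0 // => h2.
by have := le_lt_trans (le_trans h2 h1) zx; rewrite ltxx.
Qed.

(** Otherwise [x] would lie strictly between [w] and a point [u] of the open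
   disk of [disk_sub], hence in the interior of [C]. *)
Lemma support_line C p x w : convex_set (C : set (convex_lmodType plane)) ->
  interior C p -> nearest_boundary_point C p x -> C w ->
  dot (x - p) (w - p) <= dot (x - p) (x - p).
Proof.
move=> conv Cp near Cw; rewrite leNgt; apply/negP => h.
have [_ nCx] := near.1; apply: nCx.
set r2 := dot (x - p) (x - p) in h; set d := dot (x - p) (w - p) in h.
set W := dot (w - p) (w - p).
have W0 : 0 <= W by exact: dot_ge0.
have r20 : 0 <= r2 by exact: dot_ge0.
(* A small weight for [w]: the point [u] with [x = (1 - s) u + s w] is in the
   open disk when [s (W - r2) < 2 (d - r2)]. *)
pose s := (d - r2) / (d - r2 + W + 1).
have D0 : 0 < d - r2 + W + 1 by lra.
have s0 : 0 < s by rewrite divr_gt0 // subr_gt0.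
have s1 : s < 1 by rewrite ltr_pdivrMr // mul1r; lra.
have sW : s * W < d - r2.
  rewrite /s -mulrA [_^-1 * _]mulrC mulrA ltr_pdivrMr //; nra.
have s1n : 1 - s != 0 by rewrite subr_eq0 eq_sym (lt_eqF s1).
pose u := (1 - s)^-1 *: (x - s *: w).
have xE : x = (1 - s) *: u + (1 - (1 - s)) *: w.
  by rewrite /u scalerA mulfV // scale1r subKr subrK.
rewrite [in X in interior C X]xE; apply: interior_conv => //; last by lra.
have ur : dot (u - p) (u - p) < r2.
  have pos : 0 < (1 - s) ^+ 2 by rewrite exprn_gt0 // subr_gt0.
  have uE : (1 - s) ^+ 2 * dot (u - p) (u - p) = r2 - 2 * s * d + s ^+ 2 * W.
    by rewrite /r2 /d /W /u /dot !mxE; field.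
  rewrite -(ltr_pM2l pos) uE; nra.
have opn : open [set z | dot (z - p) (z - p) < r2].
  apply: (open_comp (f := fun z => dot (z - p) (z - p)) (D := [set t | t < r2])).
    by move=> z _; exact: continuous_norm2.
  exact: open_lt.
have : nbhs u [set z | dot (z - p) (z - p) < r2] by exact: open_nbhs_nbhs.
by apply: filterS => z; exact: disk_sub near.
Qed.

End Topology.

(** * Spokes and sectors *)

Section Sectors.
Context {R : realType}.
Local Notation plane := 'rV[R]_2.
Implicit Types (C : set plane) (u v w a b p x y z : plane) (s t c r theta : R).
Implicit Types (i k m : nat).

(** A vector from the center: the spokes of the partition are the segments
   from [p] to [p + spoke k (x - p) i]. *)
Definition spoke k a i : plane := rotv (i%:R * turn k) a.

(** A sector of opening [turn k < pi] is an intersection of two half-planes, so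
   cross products describe it without angles. *)
Definition sector k a i : set plane :=
  [set v | 0 <= cross (spoke k a i) v /\ 0 <= cross v (spoke k a i.+1)].

Definition open_sector k a i : set plane :=
  [set v | 0 < cross (spoke k a i) v /\ 0 < cross v (spoke k a i.+1)].

Lemma dot_spoke k a i : dot (spoke k a i) (spoke k a i) = dot a a.
Proof. exact: dot_rotv. Qed.

Lemma spokeD k a i m : spoke k a (i + m) = rotv (i%:R * turn k) (spoke k a m).
Proof. by rewrite /spoke natrD mulrDl rotvD. Qed.

Lemma spoke_periodic k a i : (0 < k)%N -> spoke k a (i + k) = spoke k a i.
Proof. by move=> k0; rewrite spokeD /spoke turn_mul // rotv_periodic. Qed.

Lemma cross_spoke_succ k a i :
  cross (spoke k a i) (spoke k a i.+1) = sin (turn k) * dot a a.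
Proof.
rewrite /spoke cross_rotvD; congr (sin _ * _).
by rewrite -[i.+1]addn1 natrD mulrDl mul1r addrAC subrr add0r.
Qed.

Lemma dot_spoke_succ k a i :
  dot (spoke k a i) (spoke k a i.+1) = cos (turn k) * dot a a.
Proof.
rewrite /spoke dot_rotvD; congr (cos _ * _).
by rewrite -[i.+1]addn1 natrD mulrDl mul1r addrAC subrr add0r.
Qed.

Lemma sector_rotv k a i v :
  sector k a i (rotv (i%:R * turn k) v) <-> sector k a 0 v.
Proof.
by rewrite /sector /= -[in spoke k a i](addn0 i) -[in spoke k a i.+1]addn1
  !spokeD !cross_rotv.
Qed.

Lemma sum_ord_gt0 k (f : nat -> R) : (0 < k)%N ->
  (forall i, (i < k)%N -> 0 < f i) -> 0 < \sum_(i < k) f i.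
Proof.
case: k => // k _ f0; rewrite big_ord_recl; apply: ltr_pwDl; first exact: f0.
by apply: sumr_ge0 => i _; exact/ltW/f0/ltn_ord.
Qed.

(** The cross products of [v] with the spokes sum up to zero and are periodic,
   so at some place they pass from nonnegative to nonpositive. *)
Lemma sector_cover k a v : (2 <= k)%N -> exists2 i, (i < k)%N & sector k a i v.
Proof.
move=> k2; have k0 : (0 < k)%N by exact: leq_trans k2.
pose f i := cross (spoke k a i) v.
have sum0 : \sum_(i < k) f i = 0.
  have crossD u w : cross (u + w) v = cross u v + cross w v by exact: crossDl.
  have cross0 : cross 0 v = 0 by rewrite /cross !mxE; ring.
  by rewrite -(big_morph (cross^~ v) crossD cross0) sum_orbit.
have per i : f (i + k)%N = f i by rewrite /f spoke_periodic.
apply: contrapT => none.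
have step i : (i < k)%N -> 0 <= f i -> 0 < f i.+1.
  move=> ik fi; rewrite ltNge; apply/negP => fi1; apply: none.
  by exists i => //; split=> //; rewrite crossC oppr_ge0.
have [i ik fi] : exists2 i, (i < k)%N & 0 <= f i.
  apply: contrapT => neg.
  have : 0 < \sum_(i < k) - f i.
    apply: (sum_ord_gt0 (f := fun i => - f i)) => // i ik.
    by rewrite oppr_gt0 ltNge; apply/negP => fi; apply: neg; exists i.
  by rewrite sumrN sum0 oppr0 ltxx.
have up m : (i <= m <= k)%N -> 0 <= f m.
  elim: m => [|m ih]; first by rewrite leqn0 andbT => /eqP <-.
  move=> /andP[]; rewrite leq_eqVlt => /orP[/eqP <- //|im mk].
  by apply/ltW/step => //; apply: ih; rewrite -ltnS im ltnW.
have f0 : 0 <= f 0 by rewrite -per; apply: up; rewrite leqnn ltnW.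
have all m : (m < k)%N -> 0 < f m.+1.
  elim: m => [|m ih] mk; first exact: step.
  by apply: step => //; apply/ltW/ih/ltnW.
suff : 0 < \sum_(i < k) f i by rewrite sum0 ltxx.
apply: sum_ord_gt0 => // -[_|m mk]; last by apply: all; exact: ltnW.
by rewrite -(per 0%N) -[(0 + k)%N](prednK k0); apply: all; rewrite prednK.
Qed.

Lemma spokesP k p x z : spokes k p x z <->
  exists i t, [/\ (i < k)%N, 0 <= t <= 1 & z = p + t *: spoke k (x - p) i].
Proof.
have e i t : p + t *: (rotation p (i%:R * (2 * pi / k%:R)) x - p) =
    p + t *: spoke k (x - p) i by rewrite rotationE addrAC subrr add0r.
split=> [[i ik [t]] /=|[i [t [ik t01 ->]]]].
  by rewrite in_itv /= e => t01 <-; exists i, t.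
by exists i => //; exists t; rewrite /= ?in_itv ?e.
Qed.

(** If [i > 0] and the sine of [i * turn k] is positive, then [i * turn k < pi]
   and the sine of [(i - 1) * turn k] is nonnegative, while the open sector requires
   it to be negative. *)
Lemma spoke_notin_open k a i t : (i < k)%N -> 0 <= t ->
  ~ open_sector k a 0 (t *: spoke k a i).
Proof.
move=> ik t0; have k0 : (0 < k)%N by exact: leq_ltn_trans ik.
rewrite /open_sector /= crossZr crossZl => -[h1 h2].
have t1 : 0 < t.
  rewrite lt_neqAle t0 andbT; apply/eqP => e.
  by move: h1; rewrite -e mul0r ltxx.
move: h1 h2; rewrite !pmulr_rgt0 // /spoke !cross_rotvD mul0r subr0 mul1r.
case: i ik => [|i] ik; first by rewrite mul0r sin0 mul0r ltxx.
have -> : turn k - i.+1%:R * turn k = - (i%:R * turn k) :> R.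
  by rewrite -natr1 mulrDl mul1r opprD addrA addrAC subrr add0r.
rewrite sinN => h1 h2.
have a0 : 0 < dot a a.
  by rewrite lt_neqAle dot_ge0 andbT; apply/eqP => e; move: h1; rewrite -e mulr0 ltxx.
move: h1 h2; rewrite !(pmulr_lgt0 _ a0) oppr_gt0 => h1 h2.
have T0 := turn_gt0 k0 : 0 < turn k :> R.
have lt2 : i.+1%:R * turn k < pi *+ 2 :> R.
  by rewrite -(turn_mul k0) ltr_pM2r // ltr_nat.
have ltpi : i.+1%:R * turn k < pi :> R.
  rewrite ltNge; apply/negP => ge.
  have : (0 : R) <= sin (i.+1%:R * turn k - pi).
    apply: sin_ge0_pi; rewrite subr_ge0 ge /= lerBlDr -mulr2n; exact: ltW.
  have := @sinDpi R (i.+1%:R * turn k - pi); rewrite subrK => e; move: h1; rewrite e; lra.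
have : (0 : R) <= sin (i%:R * turn k).
  apply: sin_ge0_pi; apply/andP; split; first by rewrite mulr_ge0 ?(ltW T0).
  by apply: ltW; apply: lt_trans ltpi; rewrite ltr_pM2r // ltr_nat.
by rewrite leNgt h2.
Qed.

End Sectors.

(** * The maximum relative diameter of a standard partition *)

Section Pieces.
Context {R : realType}.
Local Notation plane := 'rV[R]_2.
Implicit Types (C : set plane) (u v w a b p x y z : plane) (s t c r theta : R).
Implicit Types (i k m : nat).

Lemma turn3_lt_pi : turn 3 < pi :> R.
Proof. by have := @turn_lt R 2 3 isT isT; rewrite [turn 2]mulrAC divff ?mul1r. Qed.

Lemma sin_turn_gt0 k : (3 <= k)%N -> 0 < sin (turn k) :> R.
Proof.
move=> k3; have k0 : (0 < k)%N by exact: leq_trans k3.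
apply: sin_gt0_pi; rewrite turn_gt0 //=; apply: le_lt_trans turn3_lt_pi.
by move: k3; rewrite leq_eqVlt => /orP[/eqP <- //|/turn_lt h]; exact/ltW/h.
Qed.

(** The triple angle formula at [2 pi / 3] reads
   [4 c^3 - 3 c - 1 = (c - 1) (2 c + 1)^2 = 0]. *)
Lemma cos_turn_ge k : (3 <= k)%N -> - (1 / 2) <= cos (turn k) :> R.
Proof.
move=> k3; have k0 : (0 < k)%N by exact: leq_trans k3.
set T : R := turn 3.
have T0 : 0 < T by exact: turn_gt0.
have e : cos (T + (T + T)) = 1.
  rewrite (_ : T + (T + T) = 3%:R * T); first by rewrite turn_mul // cos2pi.
  by ring.
have s2 := cos2Dsin2 T.
have c1 : cos T - 1 != 0 by rewrite subr_eq0 lt_eqF // cos_turn_lt1.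
have : (cos T - 1) * (2 * cos T + 1) ^+ 2 = 0.
  move: e; rewrite !cosD sinD => e.
  have -> : (cos T - 1) * (2 * cos T + 1) ^+ 2 = 4 * cos T ^+ 3 - 3 * cos T - 1 by ring.
  apply/eqP; rewrite subr_eq0 -[X in _ == X]e; apply/eqP.
  rewrite -[X in 3 * X]mulr1 -[X in _ * (_ * X)]s2; ring.
move/eqP; rewrite mulf_eq0 (negbTE c1) sqrf_eq0 /= => /eqP c3.
have -> : - (1 / 2) = cos T by lra.
move: k3; rewrite leq_eqVlt => /orP[/eqP <- //|k3].
have kT : turn k < T by exact: turn_lt.
apply: ltW; rewrite ltr_cos ?in_itv //= ?ltW ?turn_gt0 ?turn3_lt_pi //=.
by apply: lt_trans kT _; exact: turn3_lt_pi.
Qed.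

(** This is [2 r sin (pi / k)] with [r = sqrt r2], in the form given by the law
   of cosines. *)
Definition chord (r2 : R) k : R := Num.sqrt (2 * r2 * (1 - cos (turn k))).

Lemma chord_lt r2 j k : 0 < r2 -> (2 <= j)%N -> (j < k)%N ->
  chord r2 k < chord r2 j.
Proof.
move=> r0 j2 jk; have j0 : (0 < j)%N by exact: leq_trans j2.
have k2 : (2 <= k)%N by rewrite (leq_trans j2) // ltnW.
have k0 : (0 < k)%N by exact: leq_trans k2.
have jpos : 0 < 2 * r2 * (1 - cos (turn j)).
  by rewrite !mulr_gt0 // subr_gt0 cos_turn_lt1.
rewrite ltr_sqrt // ltr_pM2l ?mulr_gt0 // ltrD2l ltrN2 ltr_cos ?in_itv /=.
- exact: turn_lt.
- by rewrite ltW ?turn_gt0 ?turn_le_pi.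
- by rewrite ltW ?turn_gt0 ?turn_le_pi.
Qed.

Lemma chordE k a i :
  chord (dot a a) k = Num.sqrt
    (dot (spoke k a i - spoke k a i.+1) (spoke k a i - spoke k a i.+1)).
Proof.
congr Num.sqrt.
have -> : forall u v : plane, dot (u - v) (u - v) = dot u u + dot v v - 2 * dot u v.
  by move=> u v; rewrite /dot !mxE; ring.
by rewrite dot_spoke_succ !dot_spoke; ring.
Qed.

Section Fixed_body.
Variables (C : set plane) (k : nat) (p x y : plane).
Hypotheses (k3 : (3 <= k)%N) (conv : convex_set (C : set (convex_lmodType plane))).
Hypotheses (closedC : closed C) (sym : symmetry_center C k p).
Hypotheses (intp : interior C p) (near : nearest_boundary_point C p x).
Hypotheses (Cy : C y).
Hypothesis far : forall z, C z -> dot (z - p) (z - p) <= dot (y - p) (y - p).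

Let a := x - p.
Let k0 : (0 < k)%N. Proof. exact: leq_trans k3. Qed.
Let Cp : C p := interior_subset intp.

Let Cx : C x.
Proof.
by have [[+ _] _] := near; rewrite -(closure_id C).1.
Qed.

Lemma nearest_gt0 : 0 < dot a a.
Proof.
rewrite lt_neqAle dot_ge0 andbT eq_sym; apply/eqP => /dot_eq0/eqP.
by rewrite subr_eq0 => /eqP e; case: near => -[_]; rewrite e.
Qed.

Let inv i : rot_invariant C p (i%:R * turn k).
Proof. by apply: rot_invariantM; case/symmetry_centerP: sym. Qed.

Lemma spoke_in i : C (p + spoke k a i).
Proof.
by have /(_ a) [+ _] := inv i; apply; rewrite /a addrC subrK.
Qed.

Lemma spoke_support i v : C (p + v) -> dot (spoke k a i) v <= dot a a.
Proof.
move=> Cv; rewrite -(rotvKn (i%:R * turn k) v) dot_rotv.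
have : C (p + rotv (- (i%:R * turn k)) v).
  by have /(_ v) [+ _] := rot_invariantN (inv i); apply.
by move/(support_line conv intp near); rewrite addrKl.
Qed.

Let cross_succ i : 0 < cross (spoke k a i) (spoke k a i.+1).
Proof. by rewrite cross_spoke_succ mulr_gt0 ?sin_turn_gt0 ?nearest_gt0. Qed.

(** The support line at the end of a spoke keeps [C] from extending beyond. *)
Lemma ray_on_spoke i t : 0 <= t -> C (p + t *: spoke k a i) ->
  spokes k p x (p + t *: spoke k a i).
Proof.
move=> t0 /(spoke_support i).
have -> : dot (spoke k a i) (t *: spoke k a i) = t * dot a a.
  by rewrite -(dot_spoke k a i) /dot !mxE; ring.
rewrite -[X in _ <= X]mul1r ler_pM2r ?nearest_gt0 // => t1.
apply/spokesP; exists (i %% k)%N, t; split; rewrite ?ltn_pmod ?t0 //.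
congr (_ + _ *: _); rewrite -/a {1}(divn_eq i k) addnC.
by elim: (i %/ k)%N => [|q ih]; rewrite ?addn0 // mulSn addnCA addnC spoke_periodic.
Qed.

(** On the border of the sector the point would be on the ray of a spoke. *)
Lemma sector_off_spokes i z : C z -> ~ spokes k p x z ->
  sector k a i (z - p) -> open_sector k a i (z - p).
Proof.
move=> Cz nz [h1 h2].
have e := cross_decomp (z - p) (lt0r_neq0 (cross_succ i)).
have zE : z = p + (z - p) by rewrite addrC subrK.
have q0 v : 0 <= cross v (z - p) ->
    0 <= cross v (z - p) / cross (spoke k a i) (spoke k a i.+1).
  by move=> ?; rewrite divr_ge0 // ltW.
have q0' : 0 <= cross (z - p) (spoke k a i.+1) / cross (spoke k a i) (spoke k a i.+1).
  by rewrite divr_ge0 // ltW.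
split; rewrite lt_neqAle ?h1 ?h2 andbT; apply/eqP => c0; apply: nz.
  move: e; rewrite -c0 mul0r scale0r addr0 => e.
  by rewrite zE e; apply: ray_on_spoke => //; rewrite -e -zE.
move: e; rewrite -c0 mul0r scale0r add0r => e.
by rewrite zE e; apply: ray_on_spoke; rewrite -?e -?zE //; exact: q0.
Qed.

Lemma open_sector_off_spokes z : open_sector k a 0 (z - p) -> ~ spokes k p x z.
Proof.
move=> h /spokesP[i [t [ik /andP[t0 _] zE]]]; move: h; rewrite zE addrKl.
exact: spoke_notin_open.
Qed.

Lemma open_open_sector i : open [set z | open_sector k a i (z - p)].
Proof.
have -> : [set z | open_sector k a i (z - p)] =
  [set z | 0 < cross (spoke k a i) (z - p)] `&`
  [set z | cross (spoke k a i.+1) (z - p) < 0].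
  have e u v : (0 < cross v u) = (cross u v < 0) by rewrite crossC oppr_gt0.
  by apply/seteqP; split=> z [h1 h2]; split=> //=; move: h2; rewrite /= e.
apply: openI.
  apply: (@open_comp _ _ (fun z : plane => cross (spoke k a i) (z - p))
    [set t | 0 < t]).
    by move=> z _; exact: continuous_cross.
  exact: open_gt.
apply: (@open_comp _ _ (fun z : plane => cross (spoke k a i.+1) (z - p))
  [set t | t < 0]).
  by move=> z _; exact: continuous_cross.
exact: open_lt.
Qed.

Lemma closed_sector i : closed [set z | sector k a i (z - p)].
Proof.
have -> : [set z | sector k a i (z - p)] =
  [set z | 0 <= cross (spoke k a i) (z - p)] `&`
  [set z | cross (spoke k a i.+1) (z - p) <= 0].
  have e u v : (0 <= cross v u) = (cross u v <= 0) by rewrite crossC oppr_ge0.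
  by apply/seteqP; split=> z [h1 h2]; split=> //=; move: h2; rewrite /= e.
apply: closedI.
  apply: (@closed_comp _ _ (fun z : plane => cross (spoke k a i) (z - p))
    [set t | 0 <= t]).
    by move=> z _; exact: continuous_cross.
  exact: closed_ge.
apply: (@closed_comp _ _ (fun z : plane => cross (spoke k a i.+1) (z - p))
  [set t | t <= 0]).
  by move=> z _; exact: continuous_cross.
exact: closed_le.
Qed.

(** On [C] minus the spokes the open and the closed sector agree, so a
   component that meets the sector is contained in it. *)
Lemma piece_sub_sector A : pieces C k p x A ->
  exists i, A `<=` C `&` [set z | sector k a i (z - p)].
Proof.
move=> [z0 [Cz0 nz0] <-].
have [i ik si] := sector_cover a (z0 - p) (ltnW k3).
exists i; set B := connected_component _ _.
have BD : B `<=` C `\` spokes k p x by exact: connected_component_sub.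
have Bz0 : B z0 by apply: connected_component_refl; split.
have BE : B `&` [set z | open_sector k a i (z - p)] = B.
  apply: component_connected.
  - by exists z0; split=> //; exact: sector_off_spokes.
  - by exists [set z | open_sector k a i (z - p)] => //; exact: open_open_sector.
  - exists [set z | sector k a i (z - p)]; first exact: closed_sector.
    apply/seteqP; split=> z [Bz sz]; split=> //.
      by case: sz => h1 h2; split; exact: ltW.
    by have [Cz nz] := BD _ Bz; exact: sector_off_spokes.
have sub : B `<=` C `&` [set z | sector k a i (z - p)].
  rewrite -BE => z [Bz [h1 h2]]; have [Cz _] := BD _ Bz.
  by split=> //; split; exact: ltW.
have /closure_id cl : closed (C `&` [set z | sector k a i (z - p)]).
  by apply: closedI => //; exact: closed_sector.
by rewrite cl; exact: closureS.
Qed.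

Definition piece_bound : R :=
  Num.max (Num.sqrt (dot (y - p) (y - p))) (chord (dot a a) k).

Lemma piece_diam A z w : pieces C k p x A -> A z -> A w ->
  eucl_dist z w <= piece_bound.
Proof.
move=> /piece_sub_sector[i sub] /sub[Cz [z1 z2]] /sub[Cw [w1 w2]].
have b0 : 0 <= piece_bound by rewrite /piece_bound le_max sqrtr_ge0.
apply/eucl_dist_le; split=> //; rewrite dot_subC.
have ge_far u : C u -> dot (u - p) (u - p) <= piece_bound ^+ 2.
  move=> /far h; apply: le_trans h _.
  rewrite -[X in X <= _](sqr_sqrtr (dot_ge0 _)) lerXn2r ?nnegrE ?sqrtr_ge0 //.
  by rewrite /piece_bound le_max lexx.
have -> : z - w = (z - p) - (w - p) by rewrite opprB addrA subrK.
have CE u : C u -> C (p + (u - p)) by rewrite addrC subrK.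
apply: (@kite_bound _ (spoke k a i) (spoke k a i.+1)) => //.
all: rewrite ?dot_spoke ?dot_spoke_succ //; try exact: ge_far; try exact/spoke_support/CE.
- have := cos_turn_ge k3; have := nearest_gt0 => r0 c0.
  by have := ler_wpM2r (ltW r0) c0; lra.
- rewrite -[X in X <= _](sqr_sqrtr (dot_ge0 _)) lerXn2r ?nnegrE ?sqrtr_ge0 //.
  by rewrite -chordE /piece_bound le_max lexx orbT.
Qed.

Lemma sector_mid z (m : plane) t : sector k a 0 z -> open_sector k a 0 m ->
  0 <= t -> t < 1 -> open_sector k a 0 (t *: z + (1 - t) *: m).
Proof.
move=> [z1 z2] [m1 m2] t0 t1; have u0 : 0 < 1 - t by rewrite subr_gt0.
by split; rewrite ?crossDr ?crossDl ?crossZr ?crossZl ltr_wpDl ?mulr_ge0 ?mulr_gt0.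
Qed.

(** The open sector is joined to the midpoint [m] of two spoke ends by segments
   that avoid the spokes, so it is contained in the component of [m]; a point of
   the closed sector is a limit of points on its segment to [m]. *)
Lemma sector_sub_piece : exists2 A, pieces C k p x A &
  C `&` [set z | sector k a 0 (z - p)] `<=` A.
Proof.
pose D := C `\` spokes k p x.
pose m := (1 / 2) *: (p + spoke k a 0) + (1 - 1 / 2) *: (p + spoke k a 1).
have Cm : C m by apply: convex_comb => //; [exact: spoke_in..|lra].
have mE : m - p = (1 / 2) *: spoke k a 0 + (1 / 2) *: spoke k a 1.
  by apply: planeP; rewrite !mxE; lra.
have om : open_sector k a 0 (m - p).
  rewrite mE; split; rewrite ?crossDr ?crossDl !(crossZr, crossZl) cross_self
    ?mulr0 ?add0r ?addr0;
    by apply: mulr_gt0; [lra|exact: cross_succ].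
have Dm : D m by split=> //; exact: open_sector_off_spokes.
exists (closure (connected_component D m)); first by exists m.
have sub t z : C z -> sector k a 0 (z - p) -> 0 <= t -> t < 1 ->
    connected_component D m (t *: z + (1 - t) *: m).
  move=> Cz sz t0 t1; exists (segment m (t *: z + (1 - t) *: m)); last first.
    by apply/segmentE; exists 1; rewrite ?lexx ?ler01 // subrr scale0r add0r scale1r.
  split; last exact: connected_segment.
    by apply/segmentE; exists 0; rewrite ?lexx ?ler01 // subr0 scale0r addr0 scale1r.
  move=> w /segmentE[s s01 wE].
  have {wE} wE : w = (s * t) *: z + (1 - s * t) *: m.
    by rewrite wE; apply: planeP; rewrite !mxE; ring.
  have [s0 s1] := andP s01.
  have st0 : 0 <= s * t by rewrite mulr_ge0.
  have st1 : s * t < 1 by apply: le_lt_trans t1; rewrite ler_piMl.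
  split; first by rewrite wE; apply: convex_comb => //; rewrite st0 ltW.
  apply: open_sector_off_spokes.
  have -> : w - p = (s * t) *: (z - p) + (1 - s * t) *: (m - p).
    by rewrite wE; apply: planeP; rewrite !mxE; ring.
  exact: sector_mid.
move=> z [Cz sz] U Uz.
have cz : nbhs (1 : R) [set t | U (m + t *: (z - m))].
  by apply: (@continuous_line _ m (z - m) 1); rewrite scale1r addrC subrK.
have [e /= e0 eU] := (nbhs_ballP _ _).1 cz.
pose d := Num.min (e / 2) 1.
have d0 : 0 < d by rewrite lt_min divr_gt0 // ltr01.
have d1 : d <= 1 by rewrite ge_min lexx orbT.
have de : d < e by rewrite gt_min; apply/orP; left; rewrite ltr_pdivrMr //; lra.
exists ((1 - d) *: z + (1 - (1 - d)) *: m); split; first by apply: sub => //; lra.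
have -> : (1 - d) *: z + (1 - (1 - d)) *: m = m + (1 - d) *: (z - m).
  by apply: planeP; rewrite !mxE; ring.
by apply: eU; rewrite /ball /= opprB addrC subrK gtr0_norm.
Qed.

(** The piece of [sector_sub_piece] attains the bound of [piece_diam]. *)
Lemma max_rel_diameter_pieces : max_rel_diameter (pieces C k p x) = piece_bound.
Proof.
have diam_le A : pieces C k p x A -> diameter A <= piece_bound.
  move=> PA; apply: ge_sup.
    case: (PA) => z0 [Cz0 nz0] <-; exists (eucl_dist z0 z0), (z0, z0) => //.
    by split; apply: subset_closure; apply: connected_component_refl; split.
  by move=> _ [[z w] [/= Az Aw] <-]; exact: piece_diam PA _ _.
have [A PA sub] := sector_sub_piece.
have ge_diam z w : A z -> A w -> eucl_dist z w <= diameter A.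
  move=> Az Aw; apply: ub_le_sup; last by exists (z, w).
  by exists piece_bound => _ [[z' w'] [/= Az' Aw'] <-]; exact: piece_diam PA _ _.
have diamA : diameter A = piece_bound.
  apply/eqP; rewrite eq_le diam_le //= /piece_bound ge_max.
  apply/andP; split.
    have [i ik sy] := sector_cover a (y - p) (ltnW k3).
    pose v := rotv (- (i%:R * turn k)) (y - p).
    have Cv : C (p + v).
      by have [_ +] := inv i v; apply; rewrite rotvKn addrC subrK.
    have Av : A (p + v).
      apply: sub; split=> //=; rewrite addrKl.
      by apply/(sector_rotv k a i); rewrite rotvKn.
    have Ap : A p.
      apply: sub; split=> //=; rewrite subrr /sector /=.
      by rewrite /cross !mxE !(mulr0, mul0r) subrr.
    apply: le_trans (ge_diam _ _ Av Ap); rewrite eucl_distE addrKl.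
    by rewrite dot_rotv.
  have Ai i : (i <= 1)%N -> A (p + spoke k a i).
    move=> i1; apply: sub; split; first exact: spoke_in.
    rewrite /= addrKl; case: i i1 => [|[|//]] _; split;
      rewrite ?cross_self //; exact/ltW/cross_succ.
  apply: le_trans (ge_diam _ _ (Ai 0%N isT) (Ai 1%N isT)).
  by rewrite eucl_distE (chordE k a 0) opprD addrACA subrr add0r.
apply/eqP; rewrite eq_le; apply/andP; split.
  by apply: ge_sup; [exists (diameter A), A|move=> _ [B PB <-]; exact: diam_le].
rewrite -diamA; apply: ub_le_sup; last by exists A.
by exists piece_bound => _ [B PB <-]; exact: diam_le.
Qed.

End Fixed_body.
End Pieces.

(** * The minimum over the divisors *)

Section Minimum.
Context {R : realType}.

(** While [f] exceeds [rho] the sequence [max rho (f i)] decreases strictly;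
   once it reaches [rho] it is constant. *)
Lemma minimum_only_at_last (n : nat) (d f : nat -> R) (rho : R) :
  (2 <= n)%N -> (forall i, (1 <= i <= n)%N -> d i = Num.max rho (f i)) ->
  (forall i j, (1 <= i)%N -> (i < j)%N -> (j <= n)%N -> f j < f i) ->
  minimum_only_at n d n <-> d n.-1 <> rho.
Proof.
move=> n2 dE fdec; have n0 := ltnW n2.
have nlt : (n.-1 < n)%N by rewrite ltn_predL.
have n1 : (1 <= n.-1 <= n)%N by rewrite -ltnS prednK // n2 leq_pred.
have nn : (1 <= n <= n)%N by rewrite leqnn n0.
have [n1' _] := andP n1.
split=> [h e|neq].
  have : minimum_at n d n.-1.
    by split=> // i hi; rewrite e dE // le_max lexx.
  by move/h => e'; move: nlt; rewrite e' ltnn.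
have fn : rho < f n.-1.
  rewrite ltNge; apply/negP => fle; apply: neq.
  by rewrite dE // max_l.
have lt_last i : (1 <= i <= n)%N -> i != n -> d n < d i.
  move=> /andP[i1 i_n] ne; have ilt : (i < n)%N by rewrite ltn_neqAle ne.
  apply: lt_le_trans (_ : f n.-1 <= _).
    by rewrite dE // gt_max fn fdec.
  rewrite dE ?i1 // le_max; apply/orP; right.
  have : (i <= n.-1)%N by rewrite -ltnS prednK.
  by rewrite leq_eqVlt => /orP[/eqP -> //|il]; apply/ltW/fdec => //; exact: leq_pred.
move=> i; split=> [[hi mini]|->].
  apply/eqP; apply: contrapT => /negP ne.
  by have := lt_le_trans (lt_last i hi ne) (mini n nn); rewrite ltxx.
by split=> // j hj; have [->//|ne] := eqVneq j n; exact/ltW/lt_last.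
Qed.

End Minimum.

Theorem lemma3p11 (R : realType) (C : set 'rV[R]_2) (chi kC : nat)
  (ks : seq nat) (P : nat -> set (set 'rV[R]_2))
  (C_body : convex_body C)
  (C_multi : multi_rot_symmetric C)
  (chi_min : minimal_degree C chi)
  (kC_max : maximal_degree C kC)
  (chi_ge3 : (3 <= chi)%N)
  (ks_sorted : sorted ltn ks)
  (ks_divisors : forall k : nat, (k \in ks) = (1 < k)%N && (k %| kC)%N)
  (P_standard : forall k : nat, k \in ks -> standard_partition C k (P k)) :
  let n := size ks in
  let k_ (i : nat) := nth 0%N ks i.-1 in
  minimum_only_at n (fun i => max_rel_diameter (P (k_ i))) n <->
  max_rel_diameter (P (k_ n.-1)) <> circumradius C.
Proof.
have [cC conv [u Cu]] := C_body.
have closedC : closed C by apply: compact_closed => //; exact: norm_hausdorff.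
have [[kC2 [p symp]] kC_ub] := kC_max.
have kC0 : (0 < kC)%N by exact: leq_trans kC2.
have intp := center_interior conv kC2 symp Cu.
have Cp := interior_subset intp.
have [y Cy far] : exists2 y, C y &
    forall z, C z -> dot (z - p) (z - p) <= dot (y - p) (y - p).
  by apply: farthest_point => //; exists p.
have circ := circumradius_center kC2 symp Cy far.
have center k q : (2 <= k)%N -> symmetry_center C k q -> q = p.
  by move=> k2 symq; apply/esym; apply: symmetry_center_unique symp symq Cy far.
have mem_ks k : rot_symmetric C k -> k \in ks.
  move=> [k2 [q symq]]; have k0 : (0 < k)%N by exact: leq_trans k2.
  rewrite ks_divisors k2 /=.
  have qp := center _ _ k2 symq; rewrite {q}qp in symq.
  have lcm0 : (0 < lcmn k kC)%N by rewrite lcmn_gt0 k0.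
  have lcm_le : (lcmn k kC <= kC)%N.
    apply: kC_ub; split; last by exists p; exact: symmetry_center_lcm.
    by apply: leq_trans kC2 _; rewrite dvdn_leq // dvdn_lcmr.
  have <- : lcmn k kC = kC.
    by apply/eqP; rewrite eqn_leq lcm_le dvdn_leq // dvdn_lcmr.
  exact: dvdn_lcml.
have [q0 [x [symq0 near _]]] := P_standard _ (mem_ks _ kC_max.1).
have {symq0} q0p := center _ _ kC2 symq0; rewrite {q0}q0p in near.
set r2 := dot (x - p) (x - p).
have r2_gt0 : 0 < r2 by exact: nearest_gt0 intp near.
have ks2 k : k \in ks -> (2 <= k)%N by rewrite ks_divisors => /andP[].
have dE k : k \in ks ->
    max_rel_diameter (P k) = Num.max (circumradius C) (chord r2 k).
  move=> kks; have [q [x' [symq nearq ->]]] := P_standard _ kks.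
  have k3 : (3 <= k)%N.
    by apply: leq_trans chi_ge3 _; apply: chi_min.2; split; [exact: ks2|exists q].
  have qp := center _ _ (ks2 _ kks) symq; rewrite {q}qp in symq nearq *.
  rewrite (max_rel_diameter_pieces k3 conv closedC symq intp nearq Cy far).
  rewrite /piece_bound circ; congr (Num.max _ (chord _ _)).
  have le1 := nearq.2 _ near.1; have le2 := near.2 _ nearq.1.
  have /eqP := le_anti (introT andP (conj le1 le2)).
  by rewrite !eucl_distE ![dot (p - _) _]dot_subC eqr_sqrt ?dot_ge0 // => /eqP.
move=> n k_.
have n2 : (2 <= n)%N.
  have [j [k [jk /mem_ks js /mem_ks kks]]] := C_multi.
  rewrite /n; case: (ks) js kks => [//|l [|//]].
  by rewrite !inE => /eqP ej /eqP ek; case: jk; rewrite ej.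
have k_in i : (1 <= i <= n)%N -> k_ i \in ks.
  by case: i => // i /andP[_ i_n]; apply: mem_nth.
apply: (minimum_only_at_last (f := fun i => chord r2 (k_ i)) n2).
  by move=> i hi; apply/dE/k_in.
move=> [//|i] [//|j] _ ij jn; apply: chord_lt => //.
  by apply/ks2/k_in; exact: leq_trans (ltnW ij) jn.
apply: (sorted_ltn_nth ltn_trans) => //; rewrite inE //.
exact: leq_trans (ltnW ij) jn.
Qed.
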